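(* Let $k\ge 1$ and $p_1,\ldots,p_k$ be positive integers, and let $G$ be a simple graph whose Seidel spectrum equals the Seidel spectrum of the complete $k$-partite graph $K_{p_1,p_2,\ldots,p_k}$. Then $G$ is switching equivalent to a complete $k$-partite graph.
   Context: All graphs are finite and simple. For a graph $G$ with vertices $v_1,\ldots,v_n$, the Seidel matrix $S(G)=(s_{ij})$ is the $n\times n$ matrix with $s_{ii}=0$, $s_{ij}=-1$ if $v_i,v_j$ are adjacent ($i\ne j$), and $s_{ij}=1$ if $v_i,v_j$ are distinct and non-adjacent; equivalently $S(G)=J-I-2A(G)$. The Seidel spectrum of $G$ is the multiset of eigenvalues of $S(G)$. For a partition $V(G)=U\cup W$, Seidel switching with respect to $U$ produces the graph $H$ on the same vertex set obtained by deleting all edges between $U$ and $W$ and adding an edge between $u\in U$ and $w\in W$ whenever $uw$ was not an edge of $G$ (edges inside $U$ and inside $W$ are unchanged). Two graphs are switching equivalent if one is obtained from the other by a Seidel switching (this is an equivalence relation). *)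

(* Defs.v *)
From mathcomp Require Import all_boot all_order all_algebra all_field.
From mathcomp Require Import finmap multiset.
Set Implicit Arguments.
Unset Strict Implicit.
Unset Printing Implicit Defensive.
Import Order.TTheory GRing.Theory Num.Theory.
Local Open Scope mset_scope.
Local Open Scope ring_scope.

Record sgraph (V : finType) := SGraph {
  adj :> rel V;
  adj_sym : symmetric adj;
  adj_irr : irreflexive adj
}.

(* Vertices are ordered by the enumeration of V; another order conjugates the
   matrix by a permutation matrix. *)
Definition seidel_matrix (V : finType) (G : sgraph V) : 'M[algC]_#|V| :=
  \matrix_(i, j)
    if i == j then 0 else if adj G (enum_val i) (enum_val j) then -1 else 1.

Definition spectrum (n : nat) (A : 'M[algC]_n) : {mset algC} :=
  seq_mset (sval (closed_field_poly_normal (char_poly A))).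

(* The multiplicity of an eigenvalue is its algebraic one, as a root of the
   characteristic polynomial. *)
Lemma spectrumE (n : nat) (A : 'M[algC]_n) :
  char_poly A = \prod_(a <- spectrum A) ('X - a%:P).
Proof.
rewrite /spectrum; case: closed_field_poly_normal => r /= Er.
rewrite (perm_big r) /=; last exact: perm_eq_seq_mset.
by rewrite {1}Er (monicP (char_poly_monic A)) scale1r.
Qed.

Definition seidel_spectrum (V : finType) (G : sgraph V) : {mset algC} :=
  spectrum (seidel_matrix G).

Section Switching.
Variables (V : finType) (G : sgraph V) (U : {set V}).

Definition switching_adj : rel V :=
  fun x y => if (x \in U) == (y \in U) then adj G x y else ~~ adj G x y.

Lemma switching_sym : symmetric switching_adj.
Proof. by move=> x y; rewrite /switching_adj eq_sym adj_sym. Qed.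

Lemma switching_irr : irreflexive switching_adj.
Proof. by move=> x; rewrite /switching_adj eqxx adj_irr. Qed.

Definition switching : sgraph V := SGraph switching_sym switching_irr.
End Switching.

Definition switching_equivalent (V : finType) (G H : sgraph V) : Prop :=
  exists U : {set V}, adj H =2 adj (switching G U).

Section CompleteMultipartite.
Variables (k : nat) (p : 'I_k -> nat).

Definition cmp_vertex : finType := {i : 'I_k & 'I_(p i)}.

Definition cmp_adj : rel cmp_vertex := fun x y => tag x != tag y.

Lemma cmp_sym : symmetric cmp_adj.
Proof. by move=> x y; rewrite /cmp_adj eq_sym. Qed.

Lemma cmp_irr : irreflexive cmp_adj.
Proof. by move=> x; rewrite /cmp_adj eqxx. Qed.

Definition complete_multipartite : sgraph cmp_vertex := SGraph cmp_sym cmp_irr.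
End CompleteMultipartite.

Definition isomorphic (V W : finType) (G : sgraph V) (H : sgraph W) : Prop :=
  exists2 f : V -> W, bijective f & forall x y, adj H (f x) (f y) = adj G x y.

Definition is_complete_multipartite (k : nat) (V : finType) (H : sgraph V) :
    Prop :=
  exists q : 'I_k -> nat,
    (forall i, (0 < q i)%N) /\ isomorphic H (complete_multipartite q).

(* Main.v *)
Require Import Defs.
From mathcomp Require Import all_boot all_order all_algebra all_field.
From mathcomp Require Import finmap multiset.
From mathcomp Require Import spectral sesquilinear ring.

(** Let [M = S(G) + I], a symmetric matrix with entries 1 and -1. When [G] is a
    switching of a complete [k]-partite graph, [M = N (2 I - J) N^T] for a signed
    incidence matrix [N] of full rank; hence [S(G)] has at most one eigenvalue
    below -1, and [M] has rank [k] (rank 1 if [k = 2]). Both facts are read off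
    the Seidel spectrum.

    Conversely, call a triple odd if it spans an odd number of edges, and call two
    vertices twins if no odd triple contains both; this is an equivalence
    relation, and odd triples are invariant under switching. If three pairwise
    non-twin vertices span an even triple, two further vertices witness the
    non-twinness, and the resulting five-vertex graph gives a plane on which [M]
    is negative definite, so two eigenvalues of [S(G)] lie below -1. Thus, in
    the absence of such a plane, the odd triples are those meeting three twin
    classes, which means that [G] is a switching of the complete multipartite
    graph on its twin classes. The rank of [M] counts these classes, except that
    1 and 2 are confused; but complete bipartite graphs and edgeless graphs are
    switchings of each other. *)

Set Implicit Arguments.
Unset Strict Implicit.
Unset Printing Implicit Defensive.
Import Order.TTheory GRing.Theory Num.Theory.
Local Open Scope ring_scope.
Local Open Scope sesquilinear_scope.

(** * Spectra of normal matrices *)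

Lemma char_poly_uconj (R : comUnitRingType) (n : nat) (P A : 'M[R]_n) :
  P \in unitmx -> char_poly (invmx P *m A *m P) = char_poly A.
Proof.
move=> uP; rewrite /char_poly /char_poly_mx.
set f := map_mx (@polyC R).
have uE : f (invmx P) *m f P = 1%:M by rewrite -map_mxM mulVmx // map_mx1.
have -> : 'X%:M - f (invmx P *m A *m P) = f (invmx P) *m ('X%:M - f A) *m f P.
  by rewrite mulmxBr mulmxBl /f !map_mxM -/f mul_mx_scalar -scalemxAl uE scalemx1.
rewrite !det_mulmx mulrAC.
by rewrite -det_mulmx uE det1 mul1r.
Qed.

Lemma mxrank_diag (F : fieldType) (n : nat) (d : 'rV[F]_n) :
  \rank (diag_mx d) = #|[pred i | d 0 i != 0]|.
Proof.
elim: n d => [|n IHn] d.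
  by rewrite (flatmx0 (diag_mx d)) mxrank0; apply/esym/eq_card0; case.
transitivity (\rank (diag_mx (row_mx (@lsubmx _ 1 1 n d) (@rsubmx _ 1 1 n d)))).
  by rewrite hsubmxK.
rewrite diag_mx_row rank_diag_block_mx IHn.
rewrite -!sum1_card [RHS]big_mkcond big_ord_recl -[in RHS]big_mkcond /=.
congr addn.
  rewrite rank_rV; congr nat_of_bool; congr negb.
  apply/eqP/eqP => [/matrixP/(_ 0 0)|d0].
    by rewrite !mxE eqxx; apply: etrans; congr (d _ _); apply: val_inj.
  apply/matrixP=> i j; rewrite !ord1 !mxE eqxx /= mulr1n -[RHS]d0.
  by congr (d _ _); apply: val_inj.
apply: eq_bigl => i; rewrite !inE !mxE; congr (d _ _ != 0).
by apply: val_inj.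
Qed.

Lemma size_spectrum (n : nat) (A : 'M[algC]_n) : size (spectrum A) = n.
Proof.
by have := size_char_poly A; rewrite spectrumE size_prod_XsubC => -[].
Qed.

Section Spectrum.
Variables (n : nat) (A : 'M[algC]_n).
Hypothesis nA : A \is normalmx.

Let d := spectral_diag A.
Let P := spectralmx A.

Lemma spectral_decomposition : A = P^t* *m diag_mx d *m P.
Proof.
rewrite -invmx_unitary ?spectral_unitarymx //.
exact/orthomx_spectralP.
Qed.

Lemma perm_spectrum_diag : perm_eq (spectrum A) [seq d 0 i | i : 'I_n].
Proof.
apply: prod_XsubC_eq; rewrite -spectrumE.
have /orthomx_spectralP eA := nA; rewrite {1}eA char_poly_uconj ?spectral_unit //.
rewrite char_poly_trig ?diag_mx_is_trig // big_image /=.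
by apply: eq_bigr => i _; rewrite mxE eqxx.
Qed.

Lemma count_spectrum (a : pred algC) :
  count a (spectrum A) = #|[pred i | a (d 0 i)]|.
Proof.
rewrite (permP perm_spectrum_diag) count_map -sum1_count -sum1_card.
by rewrite big_enum_cond; apply: eq_bigl => i; rewrite inE.
Qed.

End Spectrum.

(** * Hermitian forms and the eigenvalues below a threshold *)

Definition sqform (n : nat) (M : 'M[algC]_n) (u v : 'rV[algC]_n) : algC :=
  (u *m M *m v^t*) 0 0.

Section SquareForm.
Variables (n : nat) (M : 'M[algC]_n).

Lemma sqformDl u1 u2 v :
  sqform M (u1 + u2) v = sqform M u1 v + sqform M u2 v.
Proof. by rewrite /sqform !mulmxDl mxE. Qed.

Lemma sqformZl a u v : sqform M (a *: u) v = a * sqform M u v.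
Proof. by rewrite /sqform -!scalemxAl mxE. Qed.

Lemma sqformDr u v1 v2 :
  sqform M u (v1 + v2) = sqform M u v1 + sqform M u v2.
Proof. by rewrite /sqform linearD /= map_mxD mulmxDr mxE. Qed.

Lemma sqformZr a u v : sqform M u (a *: v) = a^* * sqform M u v.
Proof. by rewrite /sqform linearZ /= map_mxZ -scalemxAr mxE. Qed.

Lemma sqform_delta i j : sqform M (delta_mx 0 i) (delta_mx 0 j) = M i j.
Proof.
by rewrite /sqform -rowE trmx_delta map_delta_mx -colE !mxE.
Qed.

End SquareForm.

Lemma sqform_congr (m n : nat) (B : 'M[algC]_(m, n)) (M : 'M[algC]_n) u v :
  sqform (B *m M *m B^t*) u v = sqform M (u *m B) (v *m B).
Proof. by rewrite /sqform trmx_mul map_mxM !mulmxA. Qed.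

Lemma sqform_diag (n : nat) (d u : 'rV[algC]_n) :
  sqform (diag_mx d) u u = \sum_i d 0 i * `|u 0 i| ^+ 2.
Proof.
rewrite /sqform mul_mx_diag mxE; apply: eq_bigr => i _.
by rewrite !mxE normCK mulrAC mulrC.
Qed.

Lemma pencil_meets_hyperplane (n : nat) (u v : 'rV[algC]_n) (w : 'cV_n) :
  exists a b : algC, (a != 0) || (b != 0) /\ (a *: u + b *: v) *m w = 0.
Proof.
have [uw0|uw0] := eqVneq ((u *m w) 0 0) 0.
  exists 1, 0; rewrite oner_eq0; split=> //.
  by apply/matrixP=> i j; rewrite !ord1 scale0r addr0 scale1r uw0 mxE.
exists (- (v *m w) 0 0), ((u *m w) 0 0); rewrite uw0 orbT; split=> //.
apply/matrixP=> i j; rewrite !ord1 mulmxDl -!scalemxAl !mxE.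
by rewrite mulNr mulrC addNr.
Qed.

Section Inertia.
Variables (n : nat) (A : 'M[algC]_n) (t : algC).
Hypotheses (hA : A \is hermsymmx) (t_real : t \is Num.real).

Let nA := hermitian_normalmx hA.
Let d := spectral_diag A.
Let P := spectralmx A.

Let dt : 'rV[algC]_n := \row_i (d 0 i - t).

Lemma shifted_decomposition : A - t%:M = P^t* *m diag_mx dt *m P.
Proof.
have -> : diag_mx dt = diag_mx d - t%:M.
  by apply/matrixP=> i j; rewrite !mxE mulrnBl.
rewrite mulmxBr mulmxBl -spectral_decomposition // mul_mx_scalar -scalemxAl.
rewrite -invmx_unitary ?spectral_unitarymx // mulVmx ?spectral_unit //.
by rewrite scalemx1.
Qed.

(** A Hermitian matrix is unitarily diagonalizable, so the rank of a shift depends on the spectrum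
    alone. *)
Lemma mxrank_sub_scalar :
  \rank (A - t%:M) = count (predC1 t) (spectrum A).
Proof.
rewrite shifted_decomposition mxrankMfree ?row_free_unit ?spectral_unit //.
rewrite eqmxMfull; last first.
  rewrite row_full_unit -invmx_unitary ?spectral_unitarymx //.
  by rewrite unitmx_inv spectral_unit.
rewrite mxrank_diag count_spectrum //; apply: eq_card => i.
by rewrite !inE mxE subr_eq0.
Qed.

Lemma sqform_shifted u :
  sqform (A - t%:M) u u = \sum_i (d 0 i - t) * `|(u *m P^t*) 0 i| ^+ 2.
Proof.
rewrite shifted_decomposition -{2}[P]trmxCK sqform_congr sqform_diag.
by apply: eq_bigr => i _; rewrite [dt _ _]mxE.
Qed.

Lemma nonneg_on_hyperplane :
  (count (fun a => (a < t)%R) (spectrum A) <= 1)%N ->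
  exists w : 'cV[algC]_n, forall u, u *m w = 0 -> 0 <= sqform (A - t%:M) u u.
Proof.
rewrite count_spectrum // => /card_le1_eqP d1.
have dreal i : d 0 i \is Num.real.
  by have /mxOverP := hermitian_spectral_diag_real hA; apply.
case: (pickP [pred i | d 0 i < t]) => [i0 /= hi0 | noneg].
  exists (col i0 (P^t*)) => u /matrixP/(_ 0 0).
  (* Being killed by this column means having no component along the eigenvector of [i0], the only
     one with a negative coefficient. *)
  rewrite colE mulmxA -colE [LHS]mxE [RHS]mxE => uw.
  rewrite sqform_shifted sumr_ge0 // => i _.
  have [->|ni] := eqVneq i i0; first by rewrite uw normr0 expr0n mulr0.
  rewrite mulr_ge0 ?exprn_ge0 // subr_ge0 real_leNgt //.
  by apply: contra ni => hi; apply/eqP; apply: d1; rewrite inE.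
exists 0 => u _; rewrite sqform_shifted sumr_ge0 // => i _.
by rewrite mulr_ge0 ?exprn_ge0 // subr_ge0 real_leNgt // [_ < _]noneg.
Qed.

(** Two eigenvectors for eigenvalues below [t] would span a negative definite plane, and every plane
    meets the kernel of [w]. *)
Lemma count_below_le1 (w : 'cV[algC]_n) :
    (forall u, u *m w = 0 -> 0 <= sqform (A - t%:M) u u) ->
  (count (fun a => (a < t)%R) (spectrum A) <= 1)%N.
Proof.
move=> hw; rewrite count_spectrum //; apply/card_le1_eqP=> j i; rewrite !inE.
rewrite -subr_lt0 => dj; rewrite -subr_lt0 => di; apply/eqP/negPn/negP => nij.
have nji : j != i by rewrite eq_sym.
have PK : P *m P^t* = 1%:M by apply/unitarymxP/spectral_unitarymx.
have [a [b [ab0 /hw]]] := pencil_meets_hyperplane (row i P) (row j P) w.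
rewrite sqform_shifted mulmxDl -!scalemxAl.
rewrite -!row_mul PK (bigD1 i) //= (bigD1 j) //= big1 ?addr0.
  rewrite !mxE !eqxx (negPf nji) (negPf nij) !(mulr0, mulr1, addr0, add0r).
  have sq_lt0 (r x : algC) : r < 0 -> x != 0 -> r * `|x| ^+ 2 < 0.
    by move=> r0 x0; rewrite nmulr_rlt0 // exprn_gt0 // normr_gt0.
  have sq_le0 (r x : algC) : r < 0 -> r * `|x| ^+ 2 <= 0.
    by move=> r0; rewrite nmulr_rle0 // exprn_ge0.
  apply/negP; rewrite lt_geF //; case/orP: ab0 => [a0|b0].
    by apply: ltr_wnDr; [apply: sq_le0 | apply: sq_lt0].
  by apply: ltr_wnDl; [apply: sq_le0 | apply: sq_lt0].
move=> l /andP[li lj]; rewrite !mxE [i == l]eq_sym [j == l]eq_sym.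
by rewrite (negPf li) (negPf lj) !mulr0 addr0 normr0 expr0n mulr0.
Qed.

End Inertia.

(** * The matrix S + I of a switched complete multipartite graph *)

Section SeidelMatrix.
Variables (V : finType) (G : sgraph V).

(** This is S + I, written so that the results on [A - t%:M] apply with [t = -1]. *)
Definition seidel_shift : 'M[algC]_#|V| := seidel_matrix G - (-1)%:M.

Lemma seidel_shiftE i j :
  seidel_shift i j = (-1) ^+ adj G (enum_val i) (enum_val j).
Proof.
rewrite !mxE; have [->|nij] := eqVneq i j; first by rewrite adj_irr sub0r opprK.
by rewrite mulr0n subr0; case: (adj G _ _).
Qed.

Lemma seidel_hermitian : seidel_matrix G \is hermsymmx.
Proof.
apply/is_hermitianmxP; rewrite expr0 scale1r; apply/matrixP=> i j.
rewrite !mxE eq_sym adj_sym; case: eqP => _; first by rewrite /= conjC0.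
by case: ifP => _; rewrite (rmorphN1, rmorph1).
Qed.

End SeidelMatrix.

(** The switching set is given by [s] and the parts by [c]; surjectivity of [c] makes all [k] parts
    nonempty. *)
Definition switched_partition (k : nat) (V : finType) (G : sgraph V)
    (s : V -> bool) (c : V -> 'I_k) : Prop :=
  (forall i, exists x, c x = i) /\
  (forall x y, adj G x y = s x (+) s y (+) (c x != c y)).

(** This is S + I for the complete graph on [k] vertices, one for each part. *)
Definition quotient_mx (k : nat) : 'M[algC]_k := 2%:M - const_mx 1.

Lemma quotient_mxE (k : nat) (i j : 'I_k) : quotient_mx k i j = (-1) ^+ (i != j).
Proof.
rewrite !mxE; case: eqP => _ /=; last by rewrite mulr0n sub0r expr1.
by rewrite mulr1n expr0; ring.
Qed.

(** A kernel vector has all entries equal to half their sum; adding them up makes the sum vanish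
    unless [k = 2]. For [k = 2] the matrix is the outer square of (1, -1). *)
Lemma mxrank_quotient_mx (k : nat) :
  \rank (quotient_mx k) = if k == 2 then 1%N else k.
Proof.
case: ifP => [/eqP->|/negbT k2].
  have E : quotient_mx 2 =
      (\col_i (-1) ^+ (val i)) *m (\row_j (-1) ^+ (val j) : 'rV_2).
    apply/matrixP=> i j; rewrite quotient_mxE mxE big_ord1 !mxE.
    by case: i => [[|[|?]] ?] //; case: j => [[|[|?]] ?] //=; ring.
  apply/eqP; rewrite eqn_leq E (leq_trans (mxrankM_maxl _ _)) ?rank_leq_col //.
  rewrite -E lt0n mxrank_eq0; apply/eqP => /matrixP/(_ 0 0)/eqP.
  by rewrite quotient_mxE mxE eqxx oner_eq0.
apply/eqP/inj_row_free => v /rowP v0.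
have vE j : v 0 j * 2 = \sum_i v 0 i.
  apply/eqP; rewrite -subr_eq0; apply/eqP; have := v0 j.
  rewrite mulmxBr mul_mx_scalar !mxE mulrC => {2}<-; congr (_ - _).
  by apply: eq_bigr => i _; rewrite !mxE mulr1.
have : (\sum_i v 0 i) * (2 - k%:R) = 0.
  rewrite mulrBr mulr_suml (eq_bigr _ (fun j _ => vE j)).
  by rewrite sumr_const card_ord mulr_natr subrr.
move/eqP; rewrite mulf_eq0 subr_eq0 eqr_nat [2 == k]eq_sym (negPf k2) orbF.
move/eqP=> s0; apply/rowP=> j; rewrite mxE; apply/eqP.
by have /eqP := vE j; rewrite s0 mulf_eq0 pnatr_eq0 orbF.
Qed.

Section SwitchedPartition.
Variables (k : nat) (V : finType) (G : sgraph V) (s : V -> bool) (c : V -> 'I_k).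
Hypothesis Gsc : switched_partition G s c.

Definition incidence_mx : 'M[algC]_(#|V|, k) :=
  \matrix_i ((-1) ^+ s (enum_val i) *: delta_mx 0 (c (enum_val i))).

Lemma mulmx_tr_incidence (m : nat) (B : 'M[algC]_(m, k)) i j :
  (B *m incidence_mx^t*) i j = (-1) ^+ s (enum_val j) * B i (c (enum_val j)).
Proof.
rewrite mxE (bigD1 (c (enum_val j))) //= big1 ?addr0.
  by rewrite !mxE !eqxx mulr1 rmorph_sign mulrC.
by move=> l nl; rewrite !mxE (negPf nl) mulr0 rmorph0 mulr0.
Qed.

Lemma seidel_shift_factor :
  seidel_shift G = incidence_mx *m quotient_mx k *m incidence_mx^t*.
Proof.
apply/matrixP=> i j; rewrite seidel_shiftE mulmx_tr_incidence.
have -> : (incidence_mx *m quotient_mx k) i (c (enum_val j)) =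
    (row i incidence_mx *m quotient_mx k) 0 (c (enum_val j)).
  by rewrite -row_mul [RHS]mxE.
rewrite rowK -scalemxAl -rowE mxE [row _ _ _ _]mxE quotient_mxE.
by rewrite (proj2 Gsc) !signr_addb mulrCA mulrA.
Qed.

Lemma mxrank_switched_partition :
  \rank (seidel_shift G) = if k == 2 then 1%N else k.
Proof.
(* Each part contains a vertex, whose coordinate recovers the entry of [v] at that part up to
   sign. *)
have fN : row_free (incidence_mx^t*).
  apply: inj_row_free => v /rowP v0; apply/rowP=> j; rewrite [RHS]mxE.
  have [x <-] := proj1 Gsc j; have /eqP := v0 (enum_rank x).
  rewrite mulmx_tr_incidence enum_rankK [X in _ == X]mxE mulf_eq0 signr_eq0.
  by move/eqP.
rewrite seidel_shift_factor mxrankMfree // eqmxMfull ?mxrank_quotient_mx //.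
by move: fN; rewrite row_free_map /row_free mxrank_tr.
Qed.

(* The form of [2 I - J] is nonnegative on the hyperplane where [J] vanishes. *)
Lemma count_switched_partition :
  (count (fun a => (a < -1)%R) (seidel_spectrum G) <= 1)%N.
Proof.
apply: (count_below_le1 (seidel_hermitian G) (w := incidence_mx *m const_mx 1)).
move=> u; rewrite -/(seidel_shift G) seidel_shift_factor sqform_congr mulmxA.
set v := u *m _ => v0; rewrite /sqform mulmxBr.
have -> : v *m (const_mx 1 : 'M_k) = 0.
  have -> : const_mx 1 = (const_mx 1 : 'cV_k) *m (const_mx 1 : 'rV[algC]_k).
    by apply/matrixP=> i j; rewrite !mxE big_ord1 !mxE mulr1.
  by rewrite mulmxA v0 mul0mx.
rewrite subr0 mul_mx_scalar -scalemxAl mxE mulr_ge0 ?ler0n // mxE.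
by rewrite sumr_ge0 // => i _; rewrite !mxE mul_conjC_ge0.
Qed.

End SwitchedPartition.

(** * Odd triples, twins and the forbidden configuration *)

Section TwoGraph.
Variables (V : finType) (G : sgraph V).

Definition odd_triple (x y z : V) : bool :=
  adj G x y (+) adj G y z (+) adj G x z.

Definition twin (x y : V) : bool := [forall z, ~~ odd_triple x y z].

Lemma odd_tripleC12 x y z : odd_triple x y z = odd_triple y x z.
Proof.
by rewrite /odd_triple (adj_sym G x y); case: (adj G y x) (adj G y z) (adj G x z)
  => [] [] [].
Qed.

Lemma odd_tripleC23 x y z : odd_triple x y z = odd_triple x z y.
Proof.
by rewrite /odd_triple (adj_sym G y z); case: (adj G x y) (adj G z y) (adj G x z)
  => [] [] [].
Qed.

(** Each of the six pairs lies in exactly two of the four triples, so the parities add up to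
    zero. *)
Lemma odd_triple_cocycle x y z w :
  odd_triple y z w = odd_triple x y z (+) odd_triple x y w (+) odd_triple x z w.
Proof.
rewrite /odd_triple.
by case: (adj G x y) (adj G x z) (adj G x w) (adj G y z) (adj G y w) (adj G z w)
  => [] [] [] [] [] [].
Qed.

Lemma odd_tripleyy x y : odd_triple x y y = false.
Proof. by rewrite /odd_triple adj_irr addbF addbb. Qed.

Lemma twinP x y : reflect (forall z, odd_triple x y z = false) (twin x y).
Proof. by apply: (iffP forallP) => h z; [exact: negbTE | rewrite h]. Qed.

Lemma twinPn x y : reflect (exists z, odd_triple x y z) (~~ twin x y).
Proof.
by apply: (iffP forallPn) => -[z hz]; exists z; move: hz; rewrite negbK.
Qed.

Lemma twin_refl : reflexive twin.
Proof. by move=> x; apply/twinP=> z; rewrite /odd_triple adj_irr addbb. Qed.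

Lemma twin_sym : symmetric twin.
Proof. by move=> x y; apply: eq_forallb => z; rewrite odd_tripleC12. Qed.

Lemma twin_trans : transitive twin.
Proof.
move=> y x z /twinP xy /twinP yz; apply/twinP=> w.
by rewrite (odd_triple_cocycle y) !(odd_tripleC12 y x) !xy yz.
Qed.

(** After the switching that isolates [x], this is the difference of the basis vectors of [v] and
    [x]. The form of S + I on these vectors is -2 times the switched adjacency. *)
Definition apex_vector (x v : V) : 'rV[algC]_#|V| :=
  (-1) ^+ adj G x v *: delta_mx 0 (enum_rank v) - delta_mx 0 (enum_rank x).

Section Forbidden.
Variables (w : 'cV[algC]_#|V|).
Hypothesis hw : forall u, u *m w = 0 -> 0 <= sqform (seidel_shift G) u u.

Lemma sqform_apex x v1 v2 :
  sqform (seidel_shift G) (apex_vector x v1) (apex_vector x v2) = -2 * (odd_triple x v1 v2)%:R.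
Proof.
rewrite /apex_vector -!scaleN1r !(sqformDl, sqformDr, sqformZl, sqformZr) !sqform_delta.
rewrite !seidel_shiftE !enum_rankK adj_irr (adj_sym G v1 x) rmorphN1 rmorph_sign.
rewrite /odd_triple.
by case: (adj G x v1) (adj G v1 v2) (adj G x v2) => [] [] [] /=; ring.
Qed.

(* Up to switching, [x] is isolated and [z - a - y - b] is a path in which
   [a] and [b] may also be adjacent. With [e := apex_vector x], the vectors
   [e a + 2 e z] and [e b + e y] span a negative definite plane. *)
Lemma forbidden_five x y z a b :
  odd_triple x y z = false -> odd_triple x a y -> odd_triple x a z ->
  odd_triple x b y -> odd_triple x b z = false -> False.
Proof.
move=> yz ay az by_ bz.
move: (apex_vector x) (sqform_apex x) => e eE.
have [p [q [pq0 /hw]]] := pencil_meets_hyperplane (e a + 2 *: e z) (e b + e y) w.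
rewrite !(sqformDl, sqformDr, sqformZl, sqformZr) !eE rmorph_nat.
rewrite !odd_tripleyy !(odd_tripleC23 x z) !(odd_tripleC23 x y).
rewrite (odd_tripleC23 x z y) yz ay az by_ bz (odd_tripleC23 x b a).
set t := odd_triple x a b.
set Q := (X in 0 <= X).
(* Completing the square: for either value of [t] the weights are nonnegative, and those of [p] and
   [p + q] are positive. *)
have -> : Q = -2 * ((2 + (~~ t)%:R) * `|p| ^+ 2 + (~~ t)%:R * `|q| ^+ 2
                   + (1 + t%:R) * `|p + q| ^+ 2).
  by rewrite {}/Q !normCK rmorphD; case: t => /=; ring.
apply/negP; rewrite lt_geF // nmulr_rlt0 ?oppr_lt0 ?ltr0n //.
have [p0|p0] := eqVneq p 0.
  move: pq0; rewrite p0 eqxx /= add0r => q0.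
  apply: ltr_wpDl; last by rewrite mulr_gt0 ?exprn_gt0 ?normr_gt0 // ltr_wpDr.
  by rewrite addr_ge0 // mulr_ge0 ?exprn_ge0 // addr_ge0.
apply: ltr_wpDr; first by rewrite mulr_ge0 ?exprn_ge0 // addr_ge0.
apply: ltr_wpDr; first by rewrite mulr_ge0 ?exprn_ge0.
by rewrite mulr_gt0 ?exprn_gt0 ?normr_gt0 // ltr_wpDr.
Qed.

Lemma pairwise_nontwins_odd x y z :
  ~~ twin x y -> ~~ twin y z -> ~~ twin x z -> odd_triple x y z.
Proof.
case/twinPn=> a xya /twinPn[b yzb] /twinPn[c xzc]; apply: contraT => /negPf xyz.
(* Here [u] is the apex. The cocycle identity makes [e'] odd with exactly one of the pairs [u v] and
   [u w']; exchanging [v] and [w'] covers both cases. *)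
have key u v w' d e' :
    odd_triple u v w' = false -> odd_triple u v d -> odd_triple u w' d ->
    odd_triple v w' e' -> False.
  move=> uvw uvd uwd vwe; have := odd_triple_cocycle u v w' e'.
  rewrite vwe uvw /=; case uve: (odd_triple u v e');
    case uwe: (odd_triple u w' e') => // _.
    by apply: (@forbidden_five u v w' d e'); rewrite // odd_tripleC23.
  by apply: (@forbidden_five u w' v d e'); rewrite // odd_tripleC23.
(* Since [x y z] is even, [a] is odd with exactly one of [x z] and [y z]; the vertex this pair
   shares with [x y] becomes the apex. *)
have := odd_triple_cocycle x y z a; rewrite xyz xya /=.
case xza: (odd_triple x z a) => /= yza; first by case: (key x y z a b).
by case: (key y x z a c) => //; rewrite odd_tripleC12.
Qed.

(* Switching with respect to the neighbours of [x0] makes [x0] isolated; a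
   further switching with respect to its twins joins them to all other
   vertices. *)
Lemma adj_twin x0 x y :
  adj G x y = (adj G x0 x (+) twin x0 x) (+) (adj G x0 y (+) twin x0 y)
              (+) ~~ twin x y.
Proof.
suff E : odd_triple x0 x y = twin x0 x (+) twin x0 y (+) ~~ twin x y.
  move: E; rewrite /odd_triple.
  by case: (adj G x0 x) (adj G x y) (adj G x0 y) (twin x0 x) (twin x0 y)
    (twin x y) => [] [] [] [] [] [].
case Tx: (twin x0 x).
  rewrite (twinP _ _ Tx); case Ty: (twin x0 y).
    by rewrite (twin_trans _ Ty) // twin_sym.
  case Txy: (twin x y) => //; by rewrite (twin_trans Tx Txy) in Ty.
case Ty: (twin x0 y).
  rewrite odd_tripleC23 (twinP _ _ Ty); case Txy: (twin x y) => //.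
  by rewrite (twin_trans Ty) // twin_sym in Tx.
case Txy: (twin x y) => /=.
  by rewrite odd_tripleC12 odd_tripleC23 (twinP _ _ Txy).
by apply: pairwise_nontwins_odd; rewrite ?Tx ?Ty ?Txy.
Qed.

End Forbidden.

End TwoGraph.

(** * From colourings to complete multipartite graphs *)

Lemma surjective_coloring (V T : finType) (f : V -> T) :
  exists (l : nat) (c : V -> 'I_l),
    (forall i, exists x, c x = i) /\
    (forall x y, (c x == c y) = (f x == f y)).
Proof.
pose I := [set f x | x : V].
have fI x : f x \in I by apply: imset_f.
exists #|I|, (fun x => enum_rank_in (fI x) (f x)); split=> [i|x y].
  have /imsetP[x _ ix] := enum_valP i; exists x; apply: enum_val_inj.
  by rewrite enum_rankK_in ?fI.
apply/eqP/eqP => [/(congr1 enum_val)|fxy]; first by rewrite !enum_rankK_in.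
by apply: enum_val_inj; rewrite !enum_rankK_in ?fxy.
Qed.

Lemma coloring_complete_multipartite (k : nat) (V : finType) (H : sgraph V)
    (c : V -> 'I_k) :
    (forall i, exists x, c x = i) -> (forall x y, adj H x y = (c x != c y)) ->
  is_complete_multipartite k H.
Proof.
move=> c_surj adjH.
pose fiber i := {x : V | c x == i}.
exists (fun i => #|fiber i : finType|); split.
  by move=> i; have [x /eqP cx] := c_surj i; apply/card_gt0P; exists (exist _ x cx).
pose f x : cmp_vertex (fun i => #|fiber i : finType|) :=
  Tagged (fun i => 'I_#|fiber i : finType|)
    (enum_rank (exist (fun y => c y == c x) x (eqxx _))).
exists f => [|x y]; last by rewrite adjH.
exists (fun t => val (enum_val (tagged t))) => [x|[i j]] /=.
  by rewrite enum_rankK.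
rewrite /f -[j in RHS]enum_valK; move: (enum_val j) => {j} [x cx] /=.
(* Once [i] is replaced by the colour of [x], the two sides differ only in a proof of a boolean
   equality. *)
have ci := eqP cx; case: i / ci in cx *.
by rewrite (bool_irrelevance cx (eqxx _)).
Qed.

Lemma switched_partition_switching (k : nat) (V : finType) (G : sgraph V)
    (s : V -> bool) (c : V -> 'I_k) :
  switched_partition G s c ->
  exists H : sgraph V, switching_equivalent G H /\ is_complete_multipartite k H.
Proof.
move=> [c_surj adjG]; exists (switching G [set x | s x]); split.
  by exists [set x | s x].
apply: coloring_complete_multipartite c_surj _ => x y.
rewrite /= /switching_adj !inE adjG.
by case: (s x) (s y) (c x != c y) => [] [] [].
Qed.

Lemma cmp_switched_partition (k : nat) (p : 'I_k -> nat) :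
  (forall i, (0 < p i)%N) ->
  switched_partition (complete_multipartite p) (fun=> false) (fun x => tag x).
Proof. by move=> hp; split=> // i; exists (existT (fun j => 'I_(p j)) i (Ordinal (hp i))). Qed.

Lemma leq_card_surj (T U : finType) (f : T -> U) :
  (forall y, exists x, f x = y) -> (#|U| <= #|T|)%N.
Proof.
move=> f_surj; have <- : #|[set f x | x : T]| = #|U|.
  by apply: eq_card => y; have [x <-] := f_surj y; rewrite imset_f.
exact: leq_imset_card.
Qed.

(* A complete bipartite graph is a switching of an edgeless one. *)
Lemma switched_partition_le2 (l k : nat) (V : finType) (G : sgraph V)
    (s : V -> bool) (c : V -> 'I_l) :
    switched_partition G s c -> (l <= 2)%N -> (0 < k <= 2)%N -> (k <= #|V|)%N ->
  exists (s' : V -> bool) (c' : V -> 'I_k), switched_partition G s' c'.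
Proof.
move=> [_ adjG] l2 k2 kV.
have [s0 adjs0] : exists s0 : V -> bool, forall x y, adj G x y = s0 x (+) s0 y.
  exists (fun x => s x (+) (val (c x) == 0%N)) => x y; rewrite adjG -val_eqE /=.
  move: (nat_of_ord (c x)) (ltn_ord (c x)) (nat_of_ord (c y)) (ltn_ord (c y)).
  move=> i il j jl; have := leq_trans il l2; have := leq_trans jl l2.
  by case: i il => [|[|]] //; case: j jl => [|[|]] // *; case: (s x) (s y) => [] [].
have [c' c'_surj] : exists c' : V -> 'I_k, forall i, exists x, c' x = i.
  have k0 : (0 < k)%N by case/andP: k2.
  (* The first [k] vertices receive distinct colours; all later ones get the default colour 0. *)
  exists (fun x => insubd (Ordinal k0) (val (enum_rank x))) => i.
  exists (enum_val (widen_ord kV i)); apply: val_inj.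
  by rewrite enum_valK val_insubd /= ltn_ord.
exists (fun x => s0 x (+) (val (c' x) == 0%N)), c'; split=> // x y.
rewrite adjs0 -val_eqE /=; case/andP: k2 => _ k2.
move: (nat_of_ord (c' x)) (ltn_ord (c' x)) (nat_of_ord (c' y)) (ltn_ord (c' y)).
move=> i il j jl; have := leq_trans il k2; have := leq_trans jl k2.
by case: i il => [|[|]] //; case: j jl => [|[|]] // *; case: (s0 x) (s0 y) => [] [].
Qed.

(** * Reconstruction from the spectrum *)

Lemma switched_partition_exists (V : finType) (G : sgraph V) :
    (count (fun a => (a < -1)%R) (seidel_spectrum G) <= 1)%N -> (0 < #|V|)%N ->
  exists (l : nat) (s : V -> bool) (c : V -> 'I_l), switched_partition G s c.
Proof.
move=> neg1 /card_gt0P[x0 _].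
have real1 : (-1 : algC) \is Num.real by rewrite rpredN rpred1.
have [w hw] := nonneg_on_hyperplane (seidel_hermitian G) real1 neg1.
(* Vertices are coloured by their twin classes. *)
have [l [c [c_surj cE]]] := surjective_coloring (fun x => [set y | twin G x y]).
exists l, (fun x => adj G x0 x (+) twin G x0 x), c; split=> // x y.
rewrite (adj_twin hw x0) cE; congr (_ (+) ~~ _); apply/idP/eqP => [xy|/setP E].
  apply/setP=> z; rewrite !inE; apply/idP/idP; last exact: twin_trans.
  by apply: twin_trans; rewrite twin_sym.
by have := E y; rewrite !inE twin_refl.
Qed.

Theorem theorem3p3 (k : nat) (hk : (1 <= k)%N)
    (p : 'I_k -> nat) (hp : forall i : 'I_k, (0 < p i)%N)
    (V : finType) (G : sgraph V)
    (hG : seidel_spectrum G = seidel_spectrum (complete_multipartite p)) :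
  exists H : sgraph V,
    switching_equivalent G H /\ is_complete_multipartite k H.
Proof.
have Kp := cmp_switched_partition hp.
have cardV : #|V| = #|cmp_vertex p|.
  rewrite -(size_spectrum (seidel_matrix G)) -[spectrum _]/(seidel_spectrum G) hG.
  exact: size_spectrum.
have kV : (k <= #|V|)%N.
  by rewrite cardV -{1}[k]card_ord; apply: leq_card_surj (proj1 Kp).
have neg1 : (count (fun a => (a < -1)%R) (seidel_spectrum G) <= 1)%N.
  by rewrite hG; apply: count_switched_partition Kp.
have [l [s [c Gsc]]] := switched_partition_exists neg1 (leq_trans hk kV).
(* Both sides are ranks of S + I, that is, numbers of eigenvalues other than -1. *)
have rk : (if l == 2 then 1%N else l) = (if k == 2 then 1%N else k).
  rewrite -(mxrank_switched_partition Gsc) -(mxrank_switched_partition Kp).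
  rewrite !mxrank_sub_scalar ?seidel_hermitian //.
  by rewrite -[spectrum _]/(seidel_spectrum G) hG.
have [lk|nlk] := eqVneq l k.
  by case: k / lk c Gsc {hk p hp hG Kp cardV kV rk} => c;
    apply: switched_partition_switching.
(* Equal ranks with [l] different from [k] leave only the values 1 and 2. *)
have /andP[l2 k2] : ((l <= 2) && (k <= 2))%N.
  by move: rk nlk; case: eqP => [->|_]; case: eqP => [->|_] //;
    [move=> <- | move=> -> | move=> ->; rewrite eqxx].
have k12 : (0 < k <= 2)%N by rewrite hk.
have [s' [c' Gsc']] := switched_partition_le2 Gsc l2 k12 kV.
exact: switched_partition_switching Gsc'.
Qed.
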